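(* Let $\varphi \colon \mathbb{Z}^d \to \mathbb{R}^d$ be an injective map with $\varphi(0)=0$ and with magnitude $\tau = \sup_{a \in \mathbb{Z}^d} \|a - \varphi(a)\| < \infty$, let $P = \varphi(\mathbb{Z}^d)$, and let $k \geq 1$ be an integer. Let $r_k(0)$ and $R_k(0)$ be the minimum and maximum distances from $0$ of the points in the $k$-th Brillouin zone of $0 \in P$, and let $W_k(0) = R_k(0) - r_k(0)$ be its width. Then $$\sqrt[d]{k/\nu_d} - \tfrac{\sqrt d}{2} - \tau < r_k(0) < R_k(0) < \sqrt[d]{k/\nu_d} + \tfrac{\sqrt d}{2} + \tau, \qquad W_k(0) < \sqrt d + 2\tau .$$
   Context: $\|\cdot\|$ is the Euclidean norm and $\nu_d$ is the $d$-dimensional volume of the unit ball in $\mathbb{R}^d$. For a locally finite set $A \subseteq \mathbb{R}^d$ (every closed ball contains finitely many points of $A$) with $0 \in A$ and an integer $k \geq 1$, the $k$-th Brillouin zone of $0$, $\mathrm{Zone}_k(0,A)$, is the set of $x \in \mathbb{R}^d$ such that $\|x-a\| < \|x\|$ for at most $k-1$ points $a \in A\setminus\{0\}$ and $\|x-b\| \leq \|x\|$ for at least $k-1$ points $b \in A \setminus\{0\}$.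
   Formalization: For d = 1 and τ = 0 (φ the inclusion of Z in R) the first strict inequality fails, since r_k(0) = (k−1)/2 = k/ν_1 − 1/2; in that case only it is stated with ≤ instead of <. All other cases and inequalities are strict as printed; d ≥ 1 is assumed. *)

(* Defs.v *)
From HB Require Import structures.
From mathcomp Require Import all_boot all_order all_algebra.
From mathcomp Require Import mathcomp_extra boolp classical_sets functions.
From mathcomp Require Import cardinality reals ereal.
From mathcomp Require Import topology normedtype sequences exp.

Set Implicit Arguments.
Unset Strict Implicit.
Unset Printing Implicit Defensive.

Import Order.TTheory GRing.Theory Num.Theory.

Local Open Scope classical_set_scope.
Local Open Scope card_scope.
Local Open Scope ring_scope.

(* The norm [`|x|] that the library puts on ['rV[R]_d] is the maximum norm,
   hence a separate Euclidean norm. *)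
Definition enorm (R : realType) (d : nat) (x : 'rV[R]_d) : R :=
  Num.sqrt (\sum_(i < d) x 0 i ^+ 2).

Definition box (R : realType) (d : nat) (B : 'rV[R]_d * 'rV[R]_d) :
    set 'rV[R]_d :=
  [set x | forall i, B.1 0 i <= x 0 i <= B.2 0 i].

Definition box_volume (R : realType) (d : nat) (B : 'rV[R]_d * 'rV[R]_d) : R :=
  \prod_(i < d) Num.max 0 (B.2 0 i - B.1 0 i).

(* d-dimensional Lebesgue (outer) measure, for d > 0: the infimum of the total
   volumes of the countable covers by boxes. It is the volume on every
   measurable set, in particular on balls. *)
Definition volume (R : realType) (d : nat) (A : set 'rV[R]_d) : \bar R :=
  ereal_inf [set (\sum_(n <oo) (box_volume (B n))%:E)%E |
             B in [set B : nat -> 'rV[R]_d * 'rV[R]_d |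
                   A `<=` \bigcup_n box (B n)]].

Definition unit_ball_volume (R : realType) (d : nat) : R :=
  fine (volume [set x : 'rV[R]_d | enorm x <= 1]).

(* [`I_n] is {0, ..., n-1}, so [S #<= `I_n] and [`I_n #<= S] say that S has at
   most, respectively at least, n elements. *)
Definition zone (R : realType) (d k : nat) (A : set 'rV[R]_d) :
    set 'rV[R]_d :=
  [set x | [set a | [/\ A a, a != 0 & enorm (x - a) < enorm x]] #<= `I_k.-1
        /\ `I_k.-1 #<= [set b | [/\ A b, b != 0 & enorm (x - b) <= enorm x]]].

Definition displacements (R : realType) (d : nat)
    (phi : 'rV[int]_d -> 'rV[R]_d) : set R :=
  range (fun a : 'rV[int]_d => enorm (map_mx intr a - phi a)).

Definition magnitude (R : realType) (d : nat)
    (phi : 'rV[int]_d -> 'rV[R]_d) : R :=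
  sup (displacements phi).

Definition is_minimum (R : realType) (S : set R) (m : R) : Prop :=
  S m /\ lbound S m.

Definition is_maximum (R : realType) (S : set R) (m : R) : Prop :=
  S m /\ ubound S m.

(* Main.v *)
Require Import Defs.
From HB Require Import structures.
From mathcomp Require Import all_boot all_order all_algebra.
From mathcomp Require Import finmap mathcomp_extra boolp classical_sets functions.
From mathcomp Require Import cardinality reals ereal.
From mathcomp Require Import topology normedtype sequences exp.
From mathcomp Require Import realfun derive.
From mathcomp Require Import ring lra zify.
Import Order.TTheory GRing.Theory Num.Theory.
Import numFieldNormedType.Exports.

Local Open Scope classical_set_scope.
Local Open Scope ring_scope.
Set Implicit Arguments.
Unset Strict Implicit.
Unset Printing Implicit Defensive.

(** Let [x] be a point of the [k]-th zone and [r = enorm x]. The sphere of centre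
    [x] through the origin has at most [k - 1] points of [P] inside it and at
    least [k] on it or inside it, the origin included. Attach to every lattice
    point [a] the unit cube centred at [a]; these cubes tile the space, have
    half-diagonal [diag / 2 = sqrt d / 2], and [phi] moves their centres by at most
    [tau].

    Upper bound. The cubes of the [a] with [phi a] inside the sphere cover the
    balls of centre [x] and radius less than [r - diag / 2 - tau]. There are at
    most [k - 1] of them, so [r - diag / 2 - tau] is smaller than the radius [rho]
    of the ball of volume [k] ([zone_enorm_lt]).

    Lower bound. The cubes of [k] points [a] with [phi a] in the closed ball are
    contained in the ball of radius [s = r + tau + diag / 2], whose volume is thus at
    least [k], that is [rho <= s] ([ball_radius_le_zone]). The inequality is strict as
    soon as some point of the bounding sphere is in none of the cubes, because a
    further small box then fits into the ball ([cubes_lt_ball]). For [1 < d] such a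
    point exists because a cube inside a ball touches the sphere only at vertices
    ([exists_off_cubes_dim]); for [0 < tau] it is the point of the sphere behind the
    origin ([exists_off_cubes_displaced]).

    Both bounds use that the infimum over countable box covers that defines
    [volume] is at least the volume of any packing by boxes. This reduces to finite
    covers by compactness, and for finite covers it follows by counting the points
    of finer and finer grids ([integer_point_count], [finite_cover_volume],
    [packing_le_volume]).

    The minimum and maximum exist because the zone is compact: it is bounded by
    the upper bound, and closed because it is cut out by finitely many weak
    inequalities ([zone_compact]). They differ because on a ray in a generic
    direction the zone is a nondegenerate segment ([two_points_on_generic_ray]). The
    bound on the width is the difference of the two others. *)

(** * Euclidean geometry of row vectors *)

Section Euclid.
Context {R : realType} {d : nat}.
Implicit Types (x y z : 'rV[R]_d) (t : R).

Definition dot x y : R := \sum_(i < d) x 0 i * y 0 i.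

Lemma dotC x y : dot x y = dot y x.
Proof. by apply: eq_bigr => i _; rewrite mulrC. Qed.

Lemma dotDl x y z : dot (x + y) z = dot x z + dot y z.
Proof. by rewrite -big_split; apply: eq_bigr => i _; rewrite !mxE mulrDl. Qed.

Lemma dotZl t x z : dot (t *: x) z = t * dot x z.
Proof. by rewrite mulr_sumr; apply: eq_bigr => i _; rewrite !mxE mulrA. Qed.

Lemma dotNl x z : dot (- x) z = - dot x z.
Proof. by rewrite -scaleN1r dotZl mulN1r. Qed.

Lemma dotDr x y z : dot x (y + z) = dot x y + dot x z.
Proof. by rewrite !(dotC x) dotDl. Qed.

Lemma dotZr t x z : dot x (t *: z) = t * dot x z.
Proof. by rewrite !(dotC x) dotZl. Qed.

Lemma dotNr x z : dot x (- z) = - dot x z.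
Proof. by rewrite !(dotC x) dotNl. Qed.

Definition dotE := (dotDl, dotDr, dotNl, dotNr, dotZl, dotZr).

Lemma dot_ge0 x : 0 <= dot x x.
Proof. by apply: sumr_ge0 => i _; rewrite -expr2 sqr_ge0. Qed.

Lemma dot_eq0 x : (dot x x == 0) = (x == 0).
Proof.
apply/eqP/eqP => [/eqP|->]; last by rewrite /dot big1 // => i _; rewrite mxE mul0r.
rewrite psumr_eq0 => [/allP x0|i _]; last by rewrite -expr2 sqr_ge0.
apply/rowP => i; rewrite mxE; apply/eqP.
by have := x0 i (mem_index_enum i); rewrite mulf_eq0 orbb.
Qed.

Lemma enormE x : enorm x = Num.sqrt (dot x x).
Proof. by congr Num.sqrt; apply: eq_bigr => i _; rewrite expr2. Qed.

Lemma enorm_ge0 x : 0 <= enorm x.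
Proof. exact: sqrtr_ge0. Qed.

Lemma enorm_sqr x : enorm x ^+ 2 = dot x x.
Proof. by rewrite enormE sqr_sqrtr // dot_ge0. Qed.

Lemma enorm_leE x t : 0 <= t -> (enorm x <= t) = (dot x x <= t ^+ 2).
Proof. by move=> t0; rewrite -ler_sqr ?nnegrE ?enorm_ge0 // enorm_sqr. Qed.

Lemma enorm_ltE x t : 0 <= t -> (enorm x < t) = (dot x x < t ^+ 2).
Proof. by move=> t0; rewrite -ltr_sqr ?nnegrE ?enorm_ge0 // enorm_sqr. Qed.

Lemma enorm_eq0 x : (enorm x == 0) = (x == 0).
Proof. by rewrite -sqrf_eq0 enorm_sqr dot_eq0. Qed.

Lemma enorm0 : enorm (0 : 'rV[R]_d) = 0.
Proof. by apply/eqP; rewrite enorm_eq0. Qed.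

Lemma enormZ t x : enorm (t *: x) = `|t| * enorm x.
Proof. by rewrite !enormE dotZl dotZr mulrA -expr2 sqrtrM ?sqr_ge0 // sqrtr_sqr. Qed.

Lemma enormN x : enorm (- x) = enorm x.
Proof. by rewrite -scaleN1r enormZ normrN1 mul1r. Qed.

Lemma enormC x y : enorm (x - y) = enorm (y - x).
Proof. by rewrite -enormN opprB. Qed.

Lemma dot_le_enorm x y : dot x y <= enorm x * enorm y.
Proof.
have [->|x0] := eqVneq x 0; first by rewrite -(scale0r 0) dotZl enormZ normr0 !mul0r.
have [->|y0] := eqVneq y 0; first by rewrite -(scale0r 0) dotZr enormZ normr0 !mul0r mulr0.
have nx : 0 < enorm x by rewrite lt_neqAle enorm_ge0 eq_sym enorm_eq0 x0.
have ny : 0 < enorm y by rewrite lt_neqAle enorm_ge0 eq_sym enorm_eq0 y0.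
have := dot_ge0 (enorm y *: x - enorm x *: y).
rewrite !dotE -!enorm_sqr (dotC y x) => h.
have h2 : 0 <= 2 * (enorm x * enorm y) * (enorm x * enorm y - dot x y) by lra.
by rewrite pmulr_rge0 ?subr_ge0 // in h2; rewrite !mulr_gt0.
Qed.

Lemma enormD x y : enorm (x + y) <= enorm x + enorm y.
Proof.
rewrite enorm_leE ?addr_ge0 ?enorm_ge0 // !dotE (dotC y x) sqrrD !enorm_sqr.
by have := dot_le_enorm x y; lra.
Qed.

Lemma enorm_dist x y z : enorm (x - z) <= enorm (x - y) + enorm (y - z).
Proof. by rewrite -{1}(subrK y x) -addrA; exact: enormD. Qed.

Lemma coord_le_enorm x i : `|x 0 i| <= enorm x.
Proof.
rewrite -[ `|_|]sqrtr_sqr enormE ler_sqrt ?dot_ge0 // /dot (bigD1 i) //= expr2.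
by rewrite lerDl sumr_ge0 // => j _; rewrite -expr2 sqr_ge0.
Qed.

Lemma enorm_le_coord x t : 0 <= t -> (forall i, `|x 0 i| <= t) ->
  enorm x <= t * Num.sqrt d%:R.
Proof.
move=> t0 xt; rewrite enorm_leE ?mulr_ge0 ?sqrtr_ge0 // exprMn sqr_sqrtr //.
rewrite mulr_natr -[in leRHS](card_ord d) -sumr_const ler_sum // => i _.
by rewrite -expr2 -real_normK ?num_real // lerXn2r ?nnegrE.
Qed.

(** The points closer to [y] than to the origin form a half-space: after
    squaring, the quadratic terms in [x] cancel and a condition linear in [x]
    remains. *)
Lemma enorm_sub_lt x y : (enorm (x - y) < enorm x) = (dot y y < 2 * dot x y).
Proof.
rewrite enorm_ltE ?enorm_ge0 // enorm_sqr !dotE (dotC y x).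
by apply/idP/idP => ?; lra.
Qed.

Lemma enorm_sub_le x y : (enorm (x - y) <= enorm x) = (dot y y <= 2 * dot x y).
Proof.
rewrite enorm_leE ?enorm_ge0 // enorm_sqr !dotE (dotC y x).
by apply/idP/idP => ?; lra.
Qed.

Lemma dot_delta (i j : 'I_d) :
  dot (delta_mx 0 i) (delta_mx 0 j) = (i == j)%:R.
Proof.
rewrite /dot (bigD1 i) //= !mxE !eqxx mul1r eq_sym big1 ?addr0 // => h /negbTE hi.
by rewrite !mxE hi andbF mul0r.
Qed.

Lemma dot_continuous (f g : 'rV[R]_d -> 'rV[R]_d) :
  continuous f -> continuous g -> continuous (fun x => dot (f x) (g x)).
Proof.
move=> fc gc x; have F : Filter (nbhs x) by exact: nbhs_filter.
apply: (@cvg_big R 'I_d +%R 0 xpredT _ _ (nbhs x) _ _ _ F) => [|i _].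
  exact: add_continuous.
have fi : f y 0 i @[y --> x] --> f x 0 i.
  exact: (cvg_comp _ _ (fc x) (@coord_continuous R 1 d 0 i (f x))).
have gi : g y 0 i @[y --> x] --> g x 0 i.
  exact: (cvg_comp _ _ (gc x) (@coord_continuous R 1 d 0 i (g x))).
exact: (cvgM fi gi).
Qed.

Lemma enorm_continuous : continuous (@enorm R d).
Proof.
move=> x.
have -> : @enorm R d = Num.sqrt \o (fun y => dot y y).
  by apply/funext => y; rewrite enormE.
apply: continuous_comp; first by apply: dot_continuous => y; exact: cvg_id.
exact: sqrt_continuous.
Qed.

End Euclid.

(** * Counting integer points in boxes *)

(** Innermost conditions come first, so that [Num.max] and [Num.min] may be
    nested; what remains is linear arithmetic. *)
Ltac split_ifs := repeat match goal with
  | |- context [if (?x < ?y)%O then _ else _] =>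
    lazymatch constr:((x, y)) with
    | context [if _ then _ else _] => fail
    | _ => case: (ltP x y) => ?
    end
  end.

Section GridCount.
Context {R : realType} {d : nat}.
Implicit Types (B : 'rV[R]_d * 'rV[R]_d) (a b h : R).

Definition open_box B : set 'rV[R]_d :=
  [set x | forall i, B.1 0 i < x 0 i < B.2 0 i].

Definition side B (j : 'I_d) : R := Num.max 0 (B.2 0 j - B.1 0 j).

Lemma side_ge0 B j : 0 <= side B j.
Proof. by rewrite le_max lexx. Qed.

Lemma box_volumeE B : box_volume B = \prod_j side B j.
Proof. by []. Qed.

Lemma box_volume_ge0 B : 0 <= box_volume B.
Proof. by apply: prodr_ge0 => j _; exact: side_ge0. Qed.

(** The induction on [M] needs the sharper bound in which [b] is cut off at
    the last counted integer [M - 1]. *)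
Lemma count_closed_interval a b (M : nat) :
  \sum_(t < M) (a <= t%:R <= b)%R%:R <= Num.max 0 (b - a) + 1.
Proof.
suff h : \sum_(t < M) (a <= t%:R <= b)%R%:R <= Num.max 0 (Num.min b (M%:R - 1) - a + 1).
  apply: le_trans h _; rewrite ge_max !maxElt minElt.
  by split_ifs; apply/andP; split; lra.
elim: M => [|M IH]; first by rewrite big_ord0 le_max lexx.
rewrite big_ord_recr /=; apply: le_trans (lerD IH (lexx _)) _.
rewrite -natr1 !maxElt !minElt.
case: (boolP (a <= M%:R <= b)) => [/andP[? ?]|] /=.
  by split_ifs; lra.
by rewrite negb_and -!ltNge; case/orP=> ?; split_ifs; lra.
Qed.

(** As above, with [b] cut off at [M]; the hypotheses say that no integer of
    the interval escapes the range of summation. *)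
Lemma count_open_interval a b (M : nat) : 0 <= a -> b <= M%:R ->
  Num.max 0 (b - a - 1) <= \sum_(t < M) (a < t%:R < b)%R%:R.
Proof.
move=> a0 bM; rewrite ge_max sumr_ge0 //=.
suff h : Num.min b M%:R - a - 1 <= \sum_(t < M) (a < t%:R < b)%R%:R.
  by apply: le_trans h; rewrite minEle bM.
elim: {bM} M => [|M IH].
  by rewrite big_ord0 minElt; split_ifs; lra.
rewrite big_ord_recr /=; move: IH; set S := \sum_(_ < M) _ => IH.
have S0 : 0 <= S by exact: sumr_ge0.
move: IH; rewrite -natr1 !minElt.
case: (boolP (a < M%:R < b)) => [/andP[? ?]|] /=.
  by split_ifs; lra.
by rewrite negb_and -!leNgt; case/orP=> ?; split_ifs; lra.
Qed.

Lemma prod_bool (F : pred 'I_d) :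
  \prod_j (F j)%:R = [forall j, F j]%:R :> R.
Proof.
case: forallP => [FT|/forallP]; first by rewrite big1 // => j _; rewrite FT.
by rewrite negb_forall => /existsP[j /negbTE Fj]; rewrite (bigD1 j) //= Fj mul0r.
Qed.

Lemma exists_nat_ub (I : finType) (F : I -> R) : exists K : nat, forall i, F i <= K%:R.
Proof.
exists (Num.bound (\sum_i `|F i|)) => i; apply: le_trans (ler_norm _) _.
apply: le_trans (ltW (archi_boundP _)); last exact: sumr_ge0.
by rewrite (bigD1 i) //= lerDl sumr_ge0.
Qed.

(** Every integer point of the packed boxes [D i] lies in some box [B n], and
    in only one [D i]. A box with sides [l j] has at least [\prod_j (l j -
    1)] and at most [\prod_j (l j + 1)] integer points, since the count is a
    product of one-dimensional counts. This is finite additivity of the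
    volume up to an error of the order of the surface of the boxes. *)
Lemma integer_point_count (I : finType) (D : I -> 'rV[R]_d * 'rV[R]_d)
  (B : nat -> 'rV[R]_d * 'rV[R]_d) (m : nat)
  (disj : forall (i j : I) z, open_box (D i) z -> open_box (D j) z -> i = j)
  (cov : forall i z, open_box (D i) z -> exists2 n, (n < m)%N & box (B n) z) :
  \sum_i \prod_j Num.max 0 (side (D i) j - 1) <=
  \sum_(n < m) \prod_j (side (B n) j + 1).
Proof.
have [K /all_and2[K1 K2]] : exists K : nat, forall u : I * 'I_d,
    - (D u.1).1 0 u.2 <= K%:R /\ (D u.1).2 0 u.2 <= K%:R.
  have [K1 hK1] := exists_nat_ub (fun u : I * 'I_d => - (D u.1).1 0 u.2).
  have [K2 hK2] := exists_nat_ub (fun u : I * 'I_d => (D u.1).2 0 u.2).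
  exists (maxn K1 K2) => u; split.
    by apply: le_trans (hK1 u) _; rewrite ler_nat leq_maxl.
  by apply: le_trans (hK2 u) _; rewrite ler_nat leq_maxr.
(* The integer points of the cube with corners -K and K, which contains all
   [D i], are indexed by the functions to 'I_M, shifted by K. Box membership is
   a product of 0-1 indicators, so that [bigA_distr_bigA] factors the counts. *)
pose M := (K + K)%N.
pose c (t : 'I_M) : R := t%:R - K%:R.
pose p (z : {ffun 'I_d -> 'I_M}) : 'rV[R]_d := \row_j c (z j).
pose lhs := \sum_(z : {ffun 'I_d -> 'I_M}) \sum_i
  \prod_j ((D i).1 0 j < c (z j) < (D i).2 0 j)%R%:R : R.
pose rhs := \sum_(z : {ffun 'I_d -> 'I_M}) \sum_(n < m)
  \prod_j ((B n).1 0 j <= c (z j) <= (B n).2 0 j)%R%:R : R.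
apply: (@le_trans _ _ lhs).
  rewrite /lhs exchange_big /=; apply: ler_sum => i _.
  rewrite -(bigA_distr_bigA (fun j t => ((D i).1 0 j < c t < (D i).2 0 j)%R%:R)).
  apply: ler_prod => j _; rewrite le_max lexx /=.
  pose a := (D i).1 0 j + K%:R; pose b := (D i).2 0 j + K%:R.
  have -> : Num.max 0 (side (D i) j - 1) = Num.max 0 (b - a - 1).
    by rewrite /side /a /b !maxElt; split_ifs; lra.
  rewrite (eq_bigr (fun t : 'I_M => (a < t%:R < b)%R%:R)); last first.
    by move=> t _; rewrite /c ltrBDr ltrBlDr.
  apply: count_open_interval.
  - by have /= := K1 (i, j); rewrite /a; lra.
  - by have /= := K2 (i, j); rewrite /b natrD; lra.
apply: (@le_trans _ _ rhs); last first.
  rewrite /rhs exchange_big /=; apply: ler_sum => n _.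
  rewrite -(bigA_distr_bigA (fun j t => ((B n).1 0 j <= c t <= (B n).2 0 j)%R%:R)).
  apply: ler_prod => j _; rewrite sumr_ge0 //=.
  pose a := (B n).1 0 j + K%:R; pose b := (B n).2 0 j + K%:R.
  rewrite (eq_bigr (fun t : 'I_M => (a <= t%:R <= b)%R%:R)); last first.
    by move=> t _; rewrite /c lerBDr lerBlDr.
  have -> : side (B n) j = Num.max 0 (b - a) by congr Num.max; rewrite /a /b; ring.
  exact: count_closed_interval.
apply: ler_sum => z _.
under eq_bigr do rewrite prod_bool.
under [leRHS]eq_bigr do rewrite prod_bool.
have openP i : [forall j, (D i).1 0 j < c (z j) < (D i).2 0 j] -> open_box (D i) (p z).
  by move/forallP => h j; rewrite mxE.
case: (pickP (fun i => [forall j, ((D i).1 0 j < c (z j) < (D i).2 0 j)%R])) =>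
    [i hi|h0]; last first.
  by rewrite big1 ?sumr_ge0 // => i _; rewrite (h0 i).
rewrite (bigD1 i) //= hi big1 ?addr0 => [|i' ne]; last first.
  case: (boolP [forall j, _]) => // hi'.
  by rewrite (disj _ _ _ (openP _ hi) (openP _ hi')) eqxx in ne.
have [n nm hn] := cov i _ (openP _ hi).
rewrite (bigD1 (Ordinal nm)) //=.
have -> : [forall j, (B n).1 0 j <= c (z j) <= (B n).2 0 j].
  by apply/forallP => j; have := hn j; rewrite mxE.
by rewrite lerDl sumr_ge0.
Qed.
End GridCount.

(** * Volumes of packed and covering boxes *)

Section PackingCovering.
Context {R : realType} {d : nat}.
Implicit Types (x : 'rV[R]_d) (B : 'rV[R]_d * 'rV[R]_d) (t h : R).

Definition scale_box t x B := (t *: (B.1 - x), t *: (B.2 - x)).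

Lemma side_scale_box t x B j : 0 <= t -> side (scale_box t x B) j = t * side B j.
Proof.
move=> t0; rewrite /side maxr_pMr // mulr0; congr Num.max.
by rewrite /= !mxE; ring.
Qed.

Lemma prod_mulr_const t (F : 'I_d -> R) : \prod_j (t * F j) = t ^+ d * \prod_j F j.
Proof. by rewrite big_split prodr_const card_ord. Qed.

Lemma box_volume_scale_box t x B : 0 <= t ->
  box_volume (scale_box t x B) = t ^+ d * box_volume B.
Proof.
move=> t0; rewrite !box_volumeE -prod_mulr_const; apply: eq_bigr.
by move=> j _; rewrite side_scale_box.
Qed.

Lemma box_scale_box t x B z : 0 < t ->
  box (scale_box t x B) (t *: (z - x)) <-> box B z.
Proof.
move=> t0; split => h i; have := h i; rewrite /= !mxE !ler_pM2l //;
by move=> /andP[? ?]; apply/andP; split; lra.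
Qed.

Lemma open_box_scale_box t x B z : 0 < t ->
  open_box (scale_box t x B) (t *: (z - x)) <-> open_box B z.
Proof.
move=> t0; split => h i; have := h i; rewrite /= !mxE !ltr_pM2l //;
by move=> /andP[? ?]; apply/andP; split; lra.
Qed.

Lemma scale_boxK t x z : 0 < t -> z = t *: ((t^-1 *: z + x) - x).
Proof. by move=> t0; rewrite addrK scalerA mulfV ?scale1r // gt_eqF. Qed.

Lemma box_scale_boxE t x B z : 0 < t ->
  box (scale_box t x B) z <-> box B (t^-1 *: z + x).
Proof. by move=> t0; rewrite {1}(scale_boxK x z t0) box_scale_box. Qed.

Lemma open_box_scale_boxE t x B z : 0 < t ->
  open_box (scale_box t x B) z <-> open_box B (t^-1 *: z + x).
Proof. by move=> t0; rewrite {1}(scale_boxK x z t0) open_box_scale_box. Qed.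

Lemma prod_cvg0 (F : R -> 'I_d -> R) : (forall j, F h j @[h --> 0] --> F 0 j) ->
  \prod_j F h j @[h --> 0] --> \prod_j F 0 j.
Proof.
move=> FF; apply: (@cvg_big R 'I_d *%R 1 xpredT) => [|j _]; last exact: FF.
exact: mul_continuous.
Qed.

Lemma sum_cvg0 (I : finType) (F : R -> I -> R) :
  (forall j, F h j @[h --> 0] --> F 0 j) ->
  \sum_j F h j @[h --> 0] --> \sum_j F 0 j.
Proof.
move=> FF; apply: (@cvg_big R I +%R 0 xpredT) => [|j _]; last exact: FF.
exact: add_continuous.
Qed.

(** Applying [integer_point_count] to the boxes magnified by [N] and dividing
    by [N ^+ d] replaces the errors [1] by [1 / N]; they vanish in the limit. *)
Lemma finite_cover_volume (I : finType) (D : I -> 'rV[R]_d * 'rV[R]_d)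
  (B : nat -> 'rV[R]_d * 'rV[R]_d) (m : nat)
  (disj : forall (i j : I) z, open_box (D i) z -> open_box (D j) z -> i = j)
  (cov : forall i z, open_box (D i) z -> exists2 n, (n < m)%N & box (B n) z) :
  \sum_i box_volume (D i) <= \sum_(n < m) box_volume (B n).
Proof.
pose lhs h := \sum_i \prod_j Num.max 0 (side (D i) j - h).
pose rhs h := \sum_(n < m) \prod_j (side (B n) j + h).
have lhs0 : lhs h @[h --> 0] --> lhs 0.
  apply: sum_cvg0 => i; apply: prod_cvg0 => j.
  by apply: (@continuous_max _ _ (cst 0) (fun h => side (D i) j - h) 0);
    [exact: cvg_cst|apply: cvgB; [exact: cvg_cst|exact: cvg_id]].
have rhs0 : rhs h @[h --> 0] --> rhs 0.
  apply: sum_cvg0 => n; apply: prod_cvg0 => j.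
  by apply: cvgD; [exact: cvg_cst|exact: cvg_id].
have <- : lhs 0 = \sum_i box_volume (D i).
  apply: eq_bigr => i _; apply: eq_bigr => j _.
  by rewrite subr0 maxEle side_ge0.
have <- : rhs 0 = \sum_(n < m) box_volume (B n).
  by apply: eq_bigr => n _; apply: eq_bigr => j _; rewrite addr0.
have lhsn : lhs (harmonic n) @[n --> \oo] --> lhs 0.
  by apply: cvg_comp lhs0; exact: cvg_harmonic.
have rhsn : rhs (harmonic n) @[n --> \oo] --> rhs 0.
  by apply: cvg_comp rhs0; exact: cvg_harmonic.
apply: ler_cvg_to lhsn rhsn _; apply: nearW => n.
pose N : R := n.+1%:R; have N0 : 0 < N by rewrite ltr0n.
have := @integer_point_count _ _ I (fun i => scale_box N 0 (D i))
  (fun n => scale_box N 0 (B n)) m.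
have dj i j z : open_box (scale_box N 0 (D i)) z ->
    open_box (scale_box N 0 (D j)) z -> i = j.
  by rewrite !open_box_scale_boxE //; exact: disj.
have cv i z : open_box (scale_box N 0 (D i)) z ->
    exists2 n, (n < m)%N & box (scale_box N 0 (B n)) z.
  by rewrite open_box_scale_boxE // => /cov[k km ?]; exists k => //; rewrite box_scale_boxE.
move=> /(_ dj cv).
rewrite (eq_bigr (fun i => N ^+ d * \prod_j Num.max 0 (side (D i) j - N^-1)));
  last first.
  move=> i _; rewrite -prod_mulr_const; apply: eq_bigr => j _ /=.
  rewrite side_scale_box ?(ltW N0) // [RHS]maxr_pMr ?(ltW N0) // mulr0; congr Num.max.
  by rewrite mulrBr mulfV ?gt_eqF.
rewrite [leRHS](eq_bigr (fun i : 'I_m => N ^+ d * \prod_j (side (B i) j + N^-1)));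
  last first.
  move=> i _; rewrite -prod_mulr_const; apply: eq_bigr => j _ /=.
  by rewrite side_scale_box ?(ltW N0) // mulrDr mulfV ?gt_eqF.
by rewrite -!mulr_sumr ler_pM2l // exprn_gt0.
Qed.

Lemma sum_half_powers_le1 m : \sum_(n < m) (2^-1 : R) ^+ n.+1 <= 1.
Proof.
suff -> : \sum_(n < m) (2^-1 : R) ^+ n.+1 = 1 - 2^-1 ^+ m.
  by rewrite lerBlDr lerDl exprn_ge0.
elim: m => [|m IH]; first by rewrite big_ord0 expr0 subrr.
by rewrite big_ord_recr /= IH exprS; lra.
Qed.

(** The volume depends continuously on the sides, so a box can be made open
    at an arbitrarily small cost. *)
Lemma open_box_enlarge B (e : R) : 0 < e -> exists B',
  box B `<=` open_box B' /\ box_volume B' <= box_volume B + e.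
Proof.
move=> e0; pose F h := \prod_j (side B j + 2 * h).
have F0 : F h @[h --> 0] --> F 0.
  apply: prod_cvg0 => j; apply: cvgD; first exact: cvg_cst.
  by apply: cvgM; [exact: cvg_cst|exact: cvg_id].
have F0E : F 0 = box_volume B.
  by apply: eq_bigr => j _; rewrite mulr0 addr0.
have [r r0 Fr] : exists2 r : R, 0 < r & F r <= F 0 + e.
  have /cvgrPdist_le /(_ e e0) /nbhs_ballP[/= r r0 h] := F0.
  exists (r / 2); first by rewrite divr_gt0.
  have := h (r / 2); rewrite -ball_normE /= sub0r normrN gtr0_norm ?divr_gt0 //.
  move=> /(_ _)/(le_trans _) h2; rewrite -lerBlDl.
  have := ler_norm (F (r / 2) - F 0); rewrite distrC => /le_trans; apply; apply: h2 => //.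
  by lra.
exists (\row_j (B.1 0 j - r), \row_j (B.2 0 j + r)); split => [z zB j|].
  by have /andP[? ?] := zB j; rewrite /= !mxE; apply/andP; split; lra.
rewrite -F0E; apply: le_trans Fr; rewrite box_volumeE; apply: ler_prod => j _.
by rewrite side_ge0 /= /side /= !mxE !maxElt; split_ifs; lra.
Qed.

Lemma open_box_open B : open (open_box B).
Proof.
rewrite openE => z zB; have F : Filter (nbhs z) by exact: nbhs_filter.
apply: (@filter_forall _ _
    (fun j => [set y : 'rV[R]_d | B.1 0 j < y 0 j < B.2 0 j]) _ F) => j.
have /andP[zl zr] := zB j.
have coordz := @coord_continuous R 1 d 0 j z.
have lt_l := coordz _ (open_nbhs_nbhs (conj (@open_gt _ (B.1 0 j)) zl)).
have lt_r := coordz _ (open_nbhs_nbhs (conj (@open_lt _ (B.2 0 j)) zr)).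
by apply: (@filterS2 _ _ F _ _ _ _ lt_l lt_r) => y /= -> ->.
Qed.

(** Countable subadditivity for boxes: given a countable cover of [A] by
    boxes, make them open at a total cost [e], extract a finite cover by
    compactness and compare with the packing by [finite_cover_volume]. *)
Lemma packing_le_volume (A : set 'rV[R]_d) (I : finType)
  (D : I -> 'rV[R]_d * 'rV[R]_d)
  (disj : forall (i j : I) z, open_box (D i) z -> open_box (D j) z -> i = j)
  (sub : forall i, open_box (D i) `<=` A) : compact A ->
  ((\sum_i box_volume (D i))%:E <= volume A)%E.
Proof.
move=> cA; apply: le_ereal_inf_tmp => _ [B AB <-].
apply/lee_addgt0Pr => e e0.
(* the enlargement of the n-th box may cost e / 2^(n+1), which sums to at most e *)
have en0 n : 0 < e * 2^-1 ^+ n.+1 :> R by rewrite mulr_gt0 ?exprn_gt0.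
have /choice[B' BB'] n := open_box_enlarge (B n) (en0 n).
have [D' _ AD'] : finite_subset_cover [set: nat] (open_box \o B') A.
  move: cA; rewrite compact_cover; apply => [i _|z /AB[n _ zn]].
    exact: open_box_open.
  by exists n => //; exact: (BB' n).1.
pose m := (\max_(n <- finmap.enum_fset D') n).+1.
apply: (@le_trans _ _ (\sum_(n < m) box_volume (B' n))%:E).
  rewrite lee_fin; apply: finite_cover_volume disj _ => i z /sub/AD'[n nD' zn].
  exists n; first by rewrite ltnS; apply: leq_bigmax_seq.
  by move=> j; have /andP[? ?] := zn j; rewrite !ltW.
apply: (@le_trans _ _ ((\sum_(n < m) box_volume (B n))%:E + e%:E)); last first.
  rewrite leeD2r // -sumEFin -(big_mkord xpredT (fun n => (box_volume (B n))%:E)).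
  by apply: nneseries_lim_ge => n _ _; rewrite lee_fin box_volume_ge0.
rewrite -EFinD lee_fin; apply: (@le_trans _ _
    (\sum_(n < m) (box_volume (B n) + e * 2^-1 ^+ n.+1))).
  by apply: ler_sum => n _; exact: (BB' n).2.
by rewrite big_split /= lerD2l -mulr_sumr ler_piMr ?(ltW e0) ?sum_half_powers_le1.
Qed.

End PackingCovering.

(** * The volume of a ball, packings and coverings of it, lattice cubes *)

Section BallVolume.
Context {R : realType} {d : nat}.
Implicit Types (x y z : 'rV[R]_d) (B : 'rV[R]_d * 'rV[R]_d) (s t : R).

Definition eball x s : set 'rV[R]_d := [set y | enorm (y - x) <= s].

Lemma bounded_enorm (A : set 'rV[R]_d) s : (forall y, A y -> enorm y <= s) ->
  bounded_set A.
Proof.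
move=> As; exists s; split; first exact: num_real.
move=> t st y /As ys; apply: le_trans (ltW st).
have s0 : 0 <= s by apply: le_trans ys; exact: enorm_ge0.
rewrite [ `|y|]mx_normrE; apply/bigmax_leP; split=> // -[i j] _ /=.
by rewrite ord1; apply: le_trans (coord_le_enorm y j) ys.
Qed.

Lemma closed_enorm_le s : closed [set y : 'rV[R]_d | enorm y <= s].
Proof.
have -> : [set y : 'rV[R]_d | enorm y <= s] = @enorm R d @^-1` [set t | t <= s].
  by [].
by apply: preimage_closed; [move=> y _; exact: enorm_continuous|exact: closed_le].
Qed.

Lemma compact_unit_ball : compact [set y : 'rV[R]_d | enorm y <= 1].
Proof.
apply: bounded_closed_compact; first exact: (@bounded_enorm _ 1).
exact: closed_enorm_le.
Qed.

Lemma volume_ge0 (A : set 'rV[R]_d) : (0 <= volume A)%E.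
Proof.
apply: le_ereal_inf_tmp => _ [B _ <-]; apply: nneseries_ge0 => n _ _.
by rewrite lee_fin box_volume_ge0.
Qed.

Definition lat (a : 'rV[int]_d) : 'rV[R]_d := map_mx intr a.

Definition cube (a : 'rV[int]_d) := (lat a - const_mx 2^-1, lat a + const_mx 2^-1).

Lemma cubeP a z : box (cube a) z <-> forall j, `|z 0 j - lat a 0 j| <= 2^-1.
Proof.
split=> h j; have := h j; rewrite /= !mxE ler_norml;
by move=> /andP[? ?]; apply/andP; split; lra.
Qed.

Lemma open_cubeP a z : open_box (cube a) z <-> forall j, `|z 0 j - lat a 0 j| < 2^-1.
Proof.
split=> h j; have := h j; rewrite /= !mxE ltr_norml;
by move=> /andP[? ?]; apply/andP; split; lra.
Qed.

Lemma box_volume_cube a : box_volume (cube a) = 1.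
Proof.
rewrite box_volumeE big1 // => j _; rewrite /side /= !mxE.
by rewrite [X in Num.max 0 X](_ : _ = 1) ?maxElt ?ltr01 //; lra.
Qed.

Lemma open_box_sub B : open_box B `<=` box B.
Proof. by move=> z zB j; have /andP[? ?] := zB j; rewrite !ltW. Qed.

Lemma open_cube_disjoint a b z : open_box (cube a) z -> open_box (cube b) z -> a = b.
Proof.
move=> /open_cubeP za /open_cubeP zb; apply/rowP => j.
have := za j; have := zb j; rewrite !mxE !ltr_norml => /andP[b1 b2] /andP[a1 a2].
have : (a 0 j)%:~R < (b 0 j + 1)%:~R :> R by rewrite intrD1; lra.
have : (b 0 j)%:~R < (a 0 j + 1)%:~R :> R by rewrite intrD1; lra.
by rewrite !ltr_int; lia.
Qed.

Lemma cube_radius a z : box (cube a) z -> enorm (z - lat a) <= Num.sqrt d%:R / 2.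
Proof.
move=> /cubeP za; rewrite mulrC; apply: enorm_le_coord => [|j]; first by rewrite invr_ge0.
by have := za j; rewrite !mxE.
Qed.

Lemma exists_cube z : exists a, box (cube a) z.
Proof.
exists (\row_j Num.floor (z 0 j + 2^-1)); apply/cubeP => j; rewrite !mxE.
have := floor_itv (z 0 j + 2^-1); rewrite intrD1 ler_norml => /andP[? ?].
by apply/andP; split; lra.
Qed.

Hypothesis d_gt0 : (0 < d)%N.

Lemma volume_le_finite_cover (A : set 'rV[R]_d) (B : nat -> 'rV[R]_d * 'rV[R]_d) m :
  (forall z, A z -> exists2 n, (n < m)%N & box (B n) z) ->
  (volume A <= (\sum_(n < m) box_volume (B n))%:E)%E.
Proof.
move=> AB; pose B' n := if (n < m)%N then B n else (0, 0).
(* The finite cover is completed by the one-point boxes (0, 0), which have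
   volume 0 because d > 0. *)
have -> : (\sum_(n < m) box_volume (B n))%:E = (\sum_(n <oo) (box_volume (B' n))%:E)%E.
  rewrite (nneseries_split 0 m) => [|k _]; last by rewrite lee_fin box_volume_ge0.
  rewrite eseries0 ?adde0 => [|k mk _].
    rewrite add0n big_mkord sumEFin; congr EFin.
    by apply: eq_bigr => n _; rewrite /B' ltn_ord.
  rewrite /B' ltnNge mk /= box_volumeE (bigD1 (Ordinal d_gt0)) //= /side /=.
  by rewrite !mxE subrr maxxx mul0r.
apply: ereal_inf_lbound; exists B' => // z /AB[n nm zn]; exists n => //.
by rewrite /B' nm.
Qed.

(** [unit_ball_volume] is obtained by [fine], which is 0 at infinity; the
    volume is finite because the unit ball lies in one box of side 2. *)
Lemma volume_unit_ball :
  volume [set y : 'rV[R]_d | enorm y <= 1] = (unit_ball_volume R d)%:E.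
Proof.
rewrite fineK // ge0_fin_numE ?volume_ge0 //.
pose B0 : nat -> 'rV[R]_d * 'rV[R]_d := fun=> (const_mx (- 1), const_mx 1).
apply: le_lt_trans (@volume_le_finite_cover _ B0 1 _) (ltry _) => z z1.
exists 0%N => // j; rewrite !mxE -ler_norml.
exact: le_trans (coord_le_enorm z j) z1.
Qed.

Lemma unit_ball_scale x s y : 0 < s -> enorm y <= 1 <-> eball x s (s *: y + x).
Proof.
by move=> s0; rewrite /eball /= addrK enormZ gtr0_norm // ger_pMr.
Qed.

(** The homothety from the ball to the unit ball divides volumes of boxes by
    [s ^+ d], so [packing_le_volume] for the unit ball suffices. *)
Lemma packing_le_ball x s (I : finType) (D : I -> 'rV[R]_d * 'rV[R]_d)
  (disj : forall (i j : I) z, open_box (D i) z -> open_box (D j) z -> i = j)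
  (sub : forall i, open_box (D i) `<=` eball x s) : 0 < s ->
  \sum_i box_volume (D i) <= unit_ball_volume R d * s ^+ d.
Proof.
move=> s0; have sV : 0 < s^-1 by rewrite invr_gt0.
have := @packing_le_volume R d _ I (fun i => scale_box s^-1 x (D i)) _ _
  compact_unit_ball.
rewrite volume_unit_ball lee_fin => /(_ _ _)/wrap[].
- by move=> i j z; rewrite !open_box_scale_boxE //; exact: disj.
- move=> i z; rewrite open_box_scale_boxE // invrK => /sub.
  by rewrite -unit_ball_scale.
rewrite (eq_bigr (fun i => (s ^+ d)^-1 * box_volume (D i))) => [|i _]; last first.
  by rewrite box_volume_scale_box ?(ltW sV) // exprVn.
by rewrite -mulr_sumr mulrC ler_pdivrMr // exprn_gt0.
Qed.

Lemma ball_le_covering x s (B : nat -> 'rV[R]_d * 'rV[R]_d) m : 0 < s ->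
  (forall z, eball x s z -> exists2 n, (n < m)%N & box (B n) z) ->
  unit_ball_volume R d * s ^+ d <= \sum_(n < m) box_volume (B n).
Proof.
move=> s0 cov; have sV : 0 < s^-1 by rewrite invr_gt0.
have := @volume_le_finite_cover [set y : 'rV[R]_d | enorm y <= 1]
  (fun n => scale_box s^-1 x (B n)) m.
rewrite volume_unit_ball lee_fin => /(_ _)/wrap[].
  move=> z; rewrite /= (unit_ball_scale x _ s0) => /cov[n nm zn]; exists n => //.
  by rewrite box_scale_boxE // invrK.
rewrite [leRHS](eq_bigr (fun i : 'I_m => (s ^+ d)^-1 * box_volume (B i)))
    => [|i _]; last first.
  by rewrite box_volume_scale_box ?(ltW sV) // exprVn.
by rewrite -mulr_sumr mulrC ler_pdivlMr // exprn_gt0.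
Qed.

(** The ball of radius half the diagonal of a unit cube contains that cube. *)
Lemma unit_ball_volume_gt0 : 0 < unit_ball_volume R d.
Proof.
have s0 : 0 < Num.sqrt d%:R / 2 :> R by rewrite divr_gt0 // sqrtr_gt0 ltr0n.
have := @packing_le_ball 0 _ unit (fun=> cube 0) _ _ s0.
move=> /(_ _ _)/wrap[].
- by move=> [] [].
- move=> _ z /open_box_sub/cube_radius.
  by rewrite /lat /eball /= (_ : map_mx _ _ = 0) //; apply/rowP => j; rewrite !mxE.
rewrite big_const card_unit /= addr0 box_volume_cube => h.
by have := lt_le_trans ltr01 h; rewrite pmulr_lgt0 // exprn_gt0.
Qed.
End BallVolume.

(** * Cardinal comparison with an initial segment *)

Section Cardinality.
Context {T : choiceType}.
Implicit Types (A : set T) (s : seq T) (n : nat).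

Lemma card_uniq_seq s : uniq s -> ([set` s] #= `I_(size s))%card.
Proof.
move=> us; have -> : [set` s] = [set` finmap.seq_fset tt s].
  by apply/seteqP; split=> x; rewrite /mkset finmap.seq_fsetE.
by apply/card_eq_fsetP; rewrite finmap.size_seq_fset undup_id.
Qed.

Lemma finite_setE A : finite_set A -> exists s, uniq s /\ A = [set` s].
Proof.
move=> /finite_seqP[s ->]; exists (undup s); split; first exact: undup_uniq.
by apply/seteqP; split=> x /=; rewrite mem_undup.
Qed.

(** An infinite set contains arbitrarily long duplicate-free sequences; from
    a longer one the first [n] terms are kept. *)
Lemma card_ge_seqP A n : (`I_n #<= A)%card <->
  exists s, [/\ uniq s, size s = n & forall x, x \in s -> A x].
Proof.
split; last first.
  move=> [s [us <- sA]]; rewrite -(card_le_eql (card_uniq_seq us)).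
  exact: subset_card_le.
move=> nA; have [s [us ns sA]] :
    exists s, [/\ uniq s, (n <= size s)%N & forall x, x \in s -> A x].
  have [/finite_setE[s [us As]]|iA] := pselect (finite_set A).
    exists s; split=> //; last by rewrite As.
    by rewrite -card_le_II -(card_le_eqr (card_uniq_seq us)) -As.
  by have [B BA nB] := infinite_set_fset n iA; exists (finmap.enum_fset B); split.
exists (take n s); split; first exact: take_uniq.
  by rewrite size_take_min (minn_idPl ns).
by move=> x /mem_take /sA.
Qed.

Lemma card_le_seqP A n : (A #<= `I_n)%card <->
  exists s, [/\ uniq s, (size s <= n)%N & A = [set` s]].
Proof.
split=> [An|[s [us sn ->]]]; last by rewrite (card_le_eql (card_uniq_seq us)) card_le_II.
have [s [us As]] := finite_setE (card_le_finite An (finite_II n)).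
by exists s; split=> //; rewrite -card_le_II -(card_le_eql (card_uniq_seq us)) -As.
Qed.

End Cardinality.

(** * Lattice cubes inside a ball *)

Section Bounds.
Context {R : realType} {d : nat} (d_gt0 : (0 < d)%N).
Implicit Types (x y z : 'rV[R]_d) (s t : R) (a : 'rV[int]_d).
Local Notation nu := (unit_ball_volume R d).
Local Notation diag := (Num.sqrt (d%:R : R)).
Local Notation lat := (@lat R d).
Local Notation cube := (@cube R d).

(** The radius of a ball of volume [q]. *)
Definition ball_radius (q : R) : R := (q / nu) `^ (d%:R^-1).

Lemma ball_radius_gt0 q : 0 < q -> 0 < ball_radius q.
Proof. by move=> q0; rewrite powR_gt0 // divr_gt0 // unit_ball_volume_gt0. Qed.

Lemma ball_radiusK q : 0 < q -> nu * ball_radius q ^+ d = q.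
Proof.
move=> q0; have nu0 := @unit_ball_volume_gt0 R d d_gt0.
rewrite -powR_mulrn ?powR_ge0 // -powRrM mulVf ?pnatr_eq0 -?lt0n //.
by rewrite powRr1 ?divr_ge0 ?ltW // mulrC divfK // gt_eqF.
Qed.

Lemma ball_radius_le q s : 0 < q -> 0 <= s -> (ball_radius q <= s) = (q <= nu * s ^+ d).
Proof.
move=> q0 s0; rewrite -{2}(ball_radiusK q0) ler_pM2l ?unit_ball_volume_gt0 //.
by rewrite ler_pXn2r ?nnegrE // ltW // ball_radius_gt0.
Qed.

(** Both bounds on radii are proved as comparisons of volumes and transported
    here to comparisons of radii. *)
Lemma ball_radius_lt q s : 0 < q -> 0 <= s -> (ball_radius q < s) = (q < nu * s ^+ d).
Proof.
move=> q0 s0; rewrite -{2}(ball_radiusK q0) ltr_pM2l ?unit_ball_volume_gt0 //.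
by rewrite ltr_pXn2r ?nnegrE // ltW // ball_radius_gt0.
Qed.

Lemma diag_ge1 : 1 <= diag.
Proof. by rewrite -[leLHS]sqrtr1 ler_sqrt // ler1n. Qed.

(** Each cube that misses [y] misses it by a margin in some coordinate; the
    minimum of the margins over the list is positive. *)
Lemma neighbourhood_off_cubes (l : seq 'rV[int]_d) y :
  (forall a, a \in l -> ~ box (cube a) y) ->
  exists2 e : R, 0 < e & forall a z, a \in l ->
    (forall j, `|z 0 j - y 0 j| <= e) -> ~ box (cube a) z.
Proof.
elim: l => [|a l IH] ly; first by exists 1.
have [e e0 le] : _ := IH (fun b bl => ly b (@mem_behead _ (a :: l) b bl)).
have [j yj] : exists j, 2^-1 < `|y 0 j - lat a 0 j|.
  apply: contrapT => nj; apply: (ly a (mem_head _ _)); apply/cubeP => j.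
  by rewrite leNgt; apply/negP => h; apply: nj; exists j.
pose e' := (`|y 0 j - lat a 0 j| - 2^-1) / 2.
exists (Num.min e e'); first by rewrite lt_min e0 divr_gt0 // subr_gt0.
move=> b z; rewrite in_cons => /predU1P[->|bl] zy.
  move=> /cubeP /(_ j); have := zy j; rewrite le_min => /andP[_].
  rewrite distrC => zy1 za; have := lerD zy1 za.
  have := ler_distD (z 0 j) (y 0 j) (lat a 0 j); rewrite /e'; lra.
by apply: le => // i; apply: le_trans (zy i) _; rewrite ge_min lexx.
Qed.

Definition box_around y e := (y - const_mx e, y + const_mx e) : 'rV[R]_d * 'rV[R]_d.

Lemma box_aroundP y e z : open_box (box_around y e) z -> forall j, `|z 0 j - y 0 j| <= e.
Proof.
by move=> h j; have := h j; rewrite /= !mxE ler_norml => /andP[? ?]; apply/andP; split; lra.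
Qed.

Lemma cubes_le_ball (l : seq 'rV[int]_d) x s : uniq l -> 0 < s ->
  (forall a, a \in l -> box (cube a) `<=` eball x s) ->
  (size l)%:R <= nu * s ^+ d.
Proof.
move=> ul s0 lx.
have := @packing_le_ball R d d_gt0 x s 'I_(size l) (fun i => cube (nth 0 l i)) _ _ s0.
move=> /(_ _ _)/wrap[].
- move=> i j z zi zj; have := open_cube_disjoint zi zj => /eqP.
  by rewrite nth_uniq // => /eqP/val_inj.
- by move=> i z /open_box_sub; apply: lx; rewrite mem_nth.
rewrite (eq_bigr (fun=> 1)) => [|i _]; last exact: box_volume_cube.
by rewrite sumr_const card_ord.
Qed.

(** The point [y] on the boundary sphere has a neighbourhood that meets no
    cube. This neighbourhood reaches into the ball, so a small box there can
    be added to the packing, and its volume makes the inequality strict. *)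
Lemma cubes_lt_ball (l : seq 'rV[int]_d) x s y : uniq l -> 0 < s ->
  (forall a, a \in l -> box (cube a) `<=` eball x s) ->
  enorm (y - x) = s -> (forall a, a \in l -> ~ box (cube a) y) ->
  (size l)%:R < nu * s ^+ d.
Proof.
move=> ul s0 lx ys /neighbourhood_off_cubes[e e0 ye].
have sq0 : 0 < diag by rewrite sqrtr_gt0 ltr0n.
have es0 : 0 < e + 2 * s by lra.
(* The box is centred at y' = y - h (y - x), at distance h s <= e / 2 from y and
   (1 - h) s from x; its half-side f is such that its half-diagonal f sqrt d
   still fits into the remaining distance h s to the sphere. *)
pose h := e / (e + 2 * s); have h0 : 0 < h by rewrite divr_gt0.
have hs : h * s <= e / 2.
  by rewrite /h mulrAC ler_pdivrMr //; have := mulr_gt0 e0 e0; lra.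
have h1 : h <= 1 by rewrite ler_pdivrMr // mul1r; lra.
pose f := h * s / (1 + diag).
have d1 : 0 < 1 + diag by lra.
have f0 : 0 < f by apply: divr_gt0 => //; apply: mulr_gt0.
have fh : f + f * diag = h * s by rewrite -{1}(mulr1 f) -mulrDr divfK // gt_eqF.
have fd : 0 < f * diag by rewrite mulr_gt0.
pose y' := y - h *: (y - x).
pose D (i : option 'I_(size l)) := if i is Some i then cube (nth 0 l i) else box_around y' f.
have near_y z : open_box (box_around y' f) z -> forall j, `|z 0 j - y 0 j| <= e.
  move=> /box_aroundP zf j; have := zf j; rewrite !mxE.
  have := coord_le_enorm (h *: (y - x)) j; rewrite enormZ ys (gtr0_norm h0) !mxE.
  have := ler_distD (y 0 j - h * (y 0 j - x 0 j)) (z 0 j) (y 0 j).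
  by rewrite [y 0 j - _ * _ - y 0 j]addrAC subrr add0r normrN; lra.
have cube_near (i : 'I_(size l)) z : open_box (cube (nth 0 l i)) z ->
    open_box (box_around y' f) z -> False.
  by move=> /open_box_sub zi /near_y /(ye _ _ (mem_nth 0 (ltn_ord i))) /(_ zi).
have := @packing_le_ball R d d_gt0 x s _ D _ _ s0.
move=> /(_ _ _)/wrap[].
- move=> [i|] [j|] z //=; last 2 first.
  + by move=> zi zf; case: (cube_near _ _ zi zf).
  + by move=> zf zi; case: (cube_near _ _ zi zf).
  move=> zi zj; have := open_cube_disjoint zi zj => /eqP.
  by rewrite nth_uniq // => /eqP/val_inj ->.
- move=> [i|] z /=; first by move/open_box_sub; apply: lx; rewrite mem_nth.
  move=> /box_aroundP zf; rewrite /eball /=.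
  apply: le_trans (enorm_dist _ y' _) _.
  have -> : y' - x = (1 - h) *: (y - x) by rewrite /y' scalerBl scale1r addrAC.
  rewrite enormZ ys ger0_norm ?subr_ge0 //.
  have : enorm (z - y') <= f * diag.
    apply: enorm_le_coord => [|j]; first exact: ltW.
    by have := zf j; rewrite !mxE.
  by lra.
apply: lt_le_trans.
rewrite (bigD1 None) //= -[ltLHS]add0r ltr_leD //.
  rewrite box_volumeE; apply: prodr_gt0 => j _; rewrite /side /= !mxE lt_max.
  by apply/orP; right; lra.
rewrite (reindex_omap Some id) => [|[]] //=.
rewrite (eq_bigr (fun=> 1)) => [|i _]; last exact: box_volume_cube.
rewrite (eq_bigl xpredT) => [|i]; last by rewrite eqxx.
by rewrite sumr_const card_ord.
Qed.

End Bounds.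

(** * Radius bounds for a perturbed lattice *)

Section PerturbedLattice.
Context {R : realType} {d : nat} (d_gt0 : (0 < d)%N).
Context (phi : 'rV[int]_d -> 'rV[R]_d) (phi_inj : injective phi) (phi0 : phi 0 = 0)
  (tau_fin : has_ubound (displacements phi)).
Implicit Types (x y z : 'rV[R]_d) (s t : R) (a : 'rV[int]_d) (k : nat).
Local Notation nu := (unit_ball_volume R d).
Local Notation diag := (Num.sqrt (d%:R : R)).
Local Notation lat := (@lat R d).
Local Notation cube := (@cube R d).
Local Notation tau := (magnitude phi).
Local Notation radius := (@ball_radius R d).
Local Notation P := (range phi).

Lemma lat0 : lat 0 = 0.
Proof. by apply/rowP => j; rewrite !mxE. Qed.

Lemma displacement_le a : enorm (lat a - phi a) <= tau.
Proof. by apply: ub_le_sup => //; exists a. Qed.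

Lemma magnitude_ge0 : 0 <= tau.
Proof. by have := displacement_le 0; rewrite lat0 phi0 subrr enorm0. Qed.

(** Every point of the ball of centre [x] and radius [s < enorm x - diag / 2
    - tau] lies in the cube of a lattice point [a] with [enorm (x - phi a) <
    enorm x]. There are at most [k - 1] such [a], so the ball has volume at
    most [k - 1]. *)
Lemma zone_enorm_lt k x : (0 < k)%N ->
  ([set a | [/\ P a, a != 0 & (enorm (x - a) < enorm x)%R]] #<= `I_k.-1)%card ->
  enorm x < radius k%:R + diag / 2 + tau.
Proof.
move=> k0 cardA; rewrite ltNge; apply/negP => xk.
have kR : 1 <= k%:R :> R by rewrite ler1n.
(* If enorm x were too large, the radius s of a ball of volume k - 1/2 would be
   admissible; a value strictly between k - 1 and k keeps s below the radius of
   the ball of volume k and still exceeds the volume of the covering. *)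
pose q : R := k%:R - 2^-1; have q0 : 0 < q by rewrite /q; lra.
pose s := radius q; have s0 : 0 < s by exact: ball_radius_gt0.
have sk : s < radius k%:R.
  have rk0 := @ball_radius_gt0 R d d_gt0 k%:R (lt_le_trans ltr01 kR).
  rewrite /s ball_radius_lt ?(ltW rk0) // ball_radiusK //; last exact: lt_le_trans kR.
  by rewrite /q; lra.
have [l [ul lk lA]] : exists l : seq 'rV[int]_d, [/\ uniq l, (size l <= k.-1)%N &
    forall a, enorm (x - phi a) < enorm x -> a \in l].
  pose A := [set a | (enorm (x - phi a) < enorm x)%R].
  have : (A #<= `I_k.-1)%card.
    rewrite -(card_le_eql (inj_card_eq (in2W phi_inj))); apply: card_le_trans cardA.
    apply: subset_card_le => _ [a Aa <-]; split=> //.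
    by apply/eqP => pa; move: Aa; rewrite /A /= pa subr0 ltxx.
  by move/card_le_seqP => [l [ul lk lA]]; exists l; split=> // a Aa;
    suff : A a by rewrite lA.
have : nu * s ^+ d <= \sum_(n < size l) box_volume (cube (nth 0 l n)).
  apply: (ball_le_covering d_gt0 (x := x) (B := fun n => cube (nth 0 l n)) s0) => z zs.
  have [a za] := @exists_cube R d z.
  have al : a \in l.
    apply: lA; apply: le_lt_trans (enorm_dist _ z _) _.
    apply: le_lt_trans (lerD (lexx _) (enorm_dist _ (lat a) _)) _.
    have := displacement_le a; have := cube_radius za.
    by move: zs; rewrite /eball /= (enormC z x); lra.
  by exists (index a l); rewrite ?index_mem ?nth_index.
rewrite ball_radiusK // (eq_bigr (fun=> 1)) => [|i _]; last exact: box_volume_cube.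
rewrite sumr_const card_ord => ql.
have : (size l)%:R <= (k.-1)%:R :> R by rewrite ler_nat.
have kE : k%:R = k.-1%:R + 1 :> R by rewrite natr1 prednK.
by move: ql; rewrite /q kE; lra.
Qed.

(** The origin is the [k]-th point: it lies on the sphere of centre [x] and
    radius [enorm x], and the definition of the zone counts only the other
    points. *)
Lemma zone_lattice_points k x : (0 < k)%N ->
  (`I_k.-1 #<= [set b | [/\ P b, b != 0 & (enorm (x - b) <= enorm x)%R]])%card ->
  exists l : seq 'rV[int]_d, [/\ uniq l, size l = k &
    forall a, a \in l -> enorm (x - phi a) <= enorm x].
Proof.
move=> k0; set A := (X in (_ #<= X)%card) => cardA.
have /card_ge_seqP[l [ul lk lA]] : (`I_k.-1 #<= phi @^-1` A)%card.
  apply: card_le_trans cardA _.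
  rewrite {1}(_ : A = phi @` (phi @^-1` A)); first exact: card_image_le.
  by apply/seteqP; split=> [b Ab|_ [a Aa <-] //]; have [[a _ ab]] := Ab; exists a; rewrite /= ab.
exists (0 :: l); split=> [|/=|a]; last 2 first.
- by rewrite lk prednK.
- by rewrite in_cons => /predU1P[->|/lA[]//]; rewrite phi0 subr0.
rewrite /= ul andbT; apply/negP => /lA[_].
by rewrite phi0 eqxx.
Qed.

Lemma cube_sub_eball x a : enorm (x - phi a) <= enorm x ->
  box (cube a) `<=` eball x (enorm x + tau + diag / 2).
Proof.
move=> xa z za; rewrite /eball /=; apply: le_trans (enorm_dist _ (lat a) _) _.
apply: le_trans (lerD (lexx _) (enorm_dist _ (phi a) _)) _.
by have := displacement_le a; have := cube_radius za; rewrite (enormC (phi a)); lra.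
Qed.

(** The origin belongs to the sphere of centre [x] through it. Let [y] be the
    point of the larger sphere beyond the origin, seen from [x]. If [y] lies
    in the cube of [a], then [y - lat a], [lat a - phi a] and [phi a - x]
    have the maximal lengths that add up to the radius, so [phi a] is on the
    segment from [x] to [y], at distance [enorm x] from [x]: it is the
    origin, and [a = 0]. But the cube of 0 reaches only to distance [diag /
    2] from the origin, and [y] is [tau] farther. *)
Lemma exists_off_cubes_displaced x : 0 < tau -> exists2 y,
  enorm (y - x) = enorm x + tau + diag / 2 &
  forall a, enorm (x - phi a) <= enorm x -> ~ box (cube a) y.
Proof.
move=> tau0; set r := enorm x; set s := r + tau + diag / 2.
have r0 : 0 <= r by exact: enorm_ge0.
have dg : 1 <= diag by exact: diag_ge1.
have s0 : 0 < s by rewrite /s; lra.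
(* for x = 0 any unit vector serves as the direction of x *)
have [e e1 xe] : exists2 e, enorm e = 1 & x = r *: e.
  have [x0|xn0] := eqVneq x 0.
    exists (delta_mx 0 (Ordinal d_gt0)); last by rewrite /r x0 enorm0 scale0r.
    by rewrite enormE dot_delta eqxx sqrtr1.
  have rn0 : r != 0 by rewrite enorm_eq0.
  exists (r^-1 *: x); last by rewrite scalerA mulfV // scale1r.
  by rewrite enormZ normfV ger0_norm // mulVf.
have yx : x - s *: e - x = - (s *: e) by rewrite addrAC subrr add0r.
exists (x - s *: e); first by rewrite yx enormN enormZ e1 mulr1 gtr0_norm.
move=> a xa ya; have a0 : a = 0.
  apply: phi_inj; rewrite phi0.
  have [u uE] : exists u, u = phi a - x by exists (phi a - x).
  have [w wE] : exists w, w = - (s *: e) by exists (- (s *: e)).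
  have wu : enorm (w - u) <= s - r.
    rewrite wE uE -yx (_ : _ - _ = x - s *: e - phi a); last by rewrite opprB addrA subrK.
    apply: le_trans (enorm_dist _ (lat a) _) _.
    by have := displacement_le a; have := cube_radius ya; rewrite /s; lra.
  have ww : dot w w = s ^+ 2.
    by rewrite wE -enorm_sqr enormN enormZ e1 mulr1 real_normK ?num_real.
  have uu : dot u u <= r ^+ 2 by rewrite uE -enorm_sqr lerXn2r ?nnegrE ?enorm_ge0 //
      (enormC (phi a)).
  have sr : 0 <= s - r by rewrite /s; lra.
  move: wu; rewrite enorm_leE // !dotE ww (dotC u w) => wu.
  (* equality case of the triangle inequality for w = u + (w - u), in the form
     |s u - r w|^2 <= s (s - r) (|u|^2 - r^2) <= 0 *)
  have : s *: u - r *: w == 0.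
    rewrite -dot_eq0 eq_le dot_ge0 andbT !dotE ww (dotC u w).
    have h1 : 0 <= s * r * (2 * dot w u - (2 * s * r - r ^+ 2 + dot u u)).
      by rewrite mulr_ge0 ?mulr_ge0 ?(ltW s0) //; nra.
    have h2 : 0 <= s * (s - r) * (r ^+ 2 - dot u u).
      by rewrite mulr_ge0 ?mulr_ge0 ?(ltW s0) // subr_ge0.
    by lra.
  rewrite wE uE scalerN opprK scalerA mulrC -scalerA -scalerDr -xe scaler_eq0 gt_eqF //=.
  by rewrite subrK => /eqP.
have := cube_radius ya; rewrite a0 lat0 subr0.
rewrite [X in X - _]xe -scalerBl enormZ e1 mulr1 ler0_norm /s; lra.
Qed.

(** A cube inside the ball can meet the sphere only at vertices of the cube:
    a coordinate strictly between its bounds could be moved outwards, out of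
    the ball. So it suffices that the coordinate [i0] of [y] is not half an
    odd integer, and in dimension at least 2 the sphere has such points. *)
Lemma exists_off_cubes_dim x s : (1 < d)%N -> 4^-1 < s -> exists2 y, enorm (y - x) = s &
  forall a, box (cube a) `<=` eball x s -> ~ box (cube a) y.
Proof.
move=> d1 s4; pose i0 := Ordinal d_gt0; pose i1 := Ordinal d1.
(* c is the i0-coordinate of y - x: one of 0 and 1/4 works, as numbers that
   differ by 1/4 are not both half-integers; the coordinate i1 of y - x then
   makes its norm s *)
have [c [c0 cs xc]] : exists c, [/\ 0 <= c, c <= s &
    forall m : int, x 0 i0 + c != m%:~R + 2^-1].
  have [[m xm]|nm] := pselect (exists m : int, x 0 i0 = m%:~R + 2^-1); last first.
    exists 0; split=> [//||m]; first by lra.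
    by rewrite addr0; apply/eqP => xm; apply: nm; exists m.
  exists 4^-1; split=> [||n]; [lra|lra|].
  apply/eqP => xn; have : (4 * m + 1)%:~R = (4 * n)%:~R :> R.
    by rewrite intrD !intrM; lra.
  by move/eqP; rewrite eqr_int => /eqP; lia.
have sc : 0 <= s ^+ 2 - c ^+ 2 by rewrite subr_ge0 lerXn2r ?nnegrE //; lra.
pose v b : 'rV[R]_d := b *: delta_mx 0 i0 + Num.sqrt (s ^+ 2 - c ^+ 2) *: delta_mx 0 i1.
have dv b : dot (v b) (v b) = b ^+ 2 + (s ^+ 2 - c ^+ 2).
  rewrite !dotE !dot_delta !eqxx /= !mulr0 !mulr1 addr0 add0r.
  by rewrite -!expr2 sqr_sqrtr.
exists (x + v c) => [|a a_in ya].
  rewrite addrAC subrr add0r enormE dv addrCA subrr addr0 sqrtr_sqr ger0_norm //.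
  by apply: le_trans cs.
pose h := lat a 0 i0 + 2^-1 - (x + v c) 0 i0.
have vE b j : v b 0 j = b * (j == i0)%:R + v 0 0 j by rewrite !mxE mul0r add0r.
have v00 : v 0 0 i0 = 0 by rewrite !mxE /= mul0r add0r mulr0.
have y0 b : (x + v b) 0 i0 = x 0 i0 + b by rewrite mxE vE eqxx v00 mulr1 addr0.
have addE (u w : 'rV[R]_d) j : (u + w) 0 j = u 0 j + w 0 j by rewrite mxE.
have /cubeP ya' := ya.
have h0 : 0 < h.
  rewrite subr_gt0 lt_neqAle y0; apply/andP; split; first by rewrite /lat mxE xc.
  by have := ya' i0; rewrite y0 ler_norml => /andP[_]; lra.
have : box (cube a) (x + v (c + h)).
  apply/cubeP => j; have [->|ji] := eqVneq j i0.
    rewrite y0 /h y0 [X in `|X|](_ : _ = 2^-1) ?ger0_norm ?invr_ge0 //; ring.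
  by have := ya' j; rewrite (addE x (v c)) (addE x (v (c + h))) (vE c)
    (vE (c + h)) (negbTE ji) !mulr0.
move=> /a_in; rewrite /eball /= addrAC subrr add0r enorm_leE; last by lra.
rewrite dv => hc; have : 0 < h * h by rewrite mulr_gt0.
by have := mulr_ge0 c0 (ltW h0); lra.
Qed.

(** The cubes of [k] lattice points fit into a ball, whose volume is
    therefore at least [k]. *)
Lemma ball_radius_le_zone k x : (0 < k)%N ->
  (`I_k.-1 #<= [set b | [/\ P b, b != 0 & (enorm (x - b) <= enorm x)%R]])%card ->
  radius k%:R <= enorm x + tau + diag / 2.
Proof.
move=> k0 /(zone_lattice_points k0)[l [ul lk lx]].
have tau0 := magnitude_ge0; have x0 := enorm_ge0 x; have dg := @diag_ge1 R d d_gt0.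
rewrite ball_radius_le ?ltr0n //; last by lra.
rewrite -lk; apply: cubes_le_ball => // [|a /lx xa]; [lra|exact: cube_sub_eball].
Qed.

(** Equality would mean that the [k] cubes fill the ball, which the two
    lemmas [exists_off_cubes_displaced] and [exists_off_cubes_dim] exclude,
    each on its own hypothesis. *)
Lemma ball_radius_lt_zone k x : (0 < k)%N -> (1 < d)%N || (0 < tau) ->
  (`I_k.-1 #<= [set b | [/\ P b, b != 0 & (enorm (x - b) <= enorm x)%R]])%card ->
  radius k%:R < enorm x + tau + diag / 2.
Proof.
move=> k0 dt /(zone_lattice_points k0)[l [ul lk lx]].
have tau0 := magnitude_ge0; have x0 := enorm_ge0 x; have dg := @diag_ge1 R d d_gt0.
rewrite ball_radius_lt ?ltr0n //; last by lra.
have lcube a : a \in l -> box (cube a) `<=` eball x (enorm x + tau + diag / 2).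
  by move=> /lx; exact: cube_sub_eball.
have [y yx ya] : exists2 y, enorm (y - x) = enorm x + tau + diag / 2 &
    forall a, a \in l -> ~ box (cube a) y.
  case/orP: dt => [d1|/(exists_off_cubes_displaced x)[y yx ya]].
    have [|y yx ya] := @exists_off_cubes_dim x (enorm x + tau + diag / 2) d1; first by lra.
    by exists y => // a /lcube; exact: ya.
  by exists y => // a /lx; exact: ya.
by rewrite -lk; apply: cubes_lt_ball yx ya => //; lra.
Qed.

End PerturbedLattice.

(** * Generic directions *)

Section GenericDirection.
Context {R : realType} {d : nat} (d_gt0 : (0 < d)%N).
Implicit Types (u v c : 'rV[R]_d).

Lemma exists_nonroot (p : {poly R}) : p != 0 -> exists t, p.[t] != 0.
Proof.
move=> p0; apply: contrapT => nroot.
have := @max_poly_roots R p [seq i%:R | i <- iota 0 (size p)] p0.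
rewrite size_map size_iota ltnn map_inj_uniq ?iota_uniq; last first.
  by move=> i j /eqP; rewrite eqr_nat => /eqP.
suff -> : all (root p) [seq i%:R | i <- iota 0 (size p)] by move/(_ isT isT).
apply/allP => t _; apply/negPn/negP => pt; apply: nroot; exists t; exact: pt.
Qed.

(** On the moment curve (1, t, ..., t^(d-1)) the condition [dot c v = 0] is a
    nonzero polynomial equation in [t], and a finite product of nonzero
    polynomials has a non-root. *)
Lemma exists_generic_direction (l : seq 'rV[R]_d) : (forall c, c \in l -> c != 0) ->
  exists2 v, v != 0 & forall c, c \in l -> dot c v != 0.
Proof.
move=> l0; pose moment (t : R) : 'rV[R]_d := \row_i t ^+ i.
pose p c := \sum_(i < d) c 0 i *: 'X^i : {poly R}.
have pE c t : (p c).[t] = dot c (moment t).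
  rewrite horner_sum; apply: eq_bigr => i _.
  by rewrite hornerZ hornerXn mxE.
have p_neq0 c : c != 0 -> p c != 0.
  apply: contra_neq => pc0; apply/rowP => i; rewrite mxE.
  have := congr1 (fun q : {poly R} => q`_i) pc0; rewrite coef0 coef_sum.
  rewrite (bigD1 i) //= coefZ coefXn eqxx mulr1 big1 ?addr0 // => j ji.
  by rewrite coefZ coefXn (inj_eq val_inj) eq_sym (negbTE ji) mulr0.
have [t pt] : exists t, (\prod_(c <- l) p c).[t] != 0.
  apply: exists_nonroot; rewrite prodf_seq_neq0; apply/allP => c cl.
  by apply/p_neq0/l0.
exists (moment t) => [|c cl].
  apply/eqP => /rowP /(_ (Ordinal d_gt0)); rewrite !mxE expr0 => /eqP.
  by rewrite oner_eq0.
by move: pt; rewrite horner_prod prodf_seq_neq0 => /allP /(_ c cl); rewrite pE.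
Qed.
End GenericDirection.

(** * Zones as counting conditions on a finite set *)

Section ZoneFinite.
Context {R : realType} {d : nat}.
Context (phi : 'rV[int]_d -> 'rV[R]_d) (tau_fin : has_ubound (displacements phi)).
Implicit Types (x y z : 'rV[R]_d) (M : R) (F : seq 'rV[R]_d) (k n : nat).
Local Notation P := (range phi).

Lemma finite_lattice_box (N : nat) :
  finite_set [set a : 'rV[int]_d | forall j, (`|a 0 j| <= N%:Z)%R].
Proof.
pose f (g : {ffun 'I_d -> 'I_(N + N).+1}) : 'rV[int]_d := \row_j ((g j)%:Z - N%:Z).
apply: sub_finite_set (finite_image f (@finite_finset _ setT)).
move=> a aN; exists [ffun j => inord (absz (a 0%R j + N%:Z)%R)] => //.
apply/rowP => j; rewrite mxE ffunE inordK; have := aN j; lia.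
Qed.

Lemma finite_points M : finite_set [set p | [/\ P p, p != 0 & enorm p <= M]].
Proof.
pose N := Num.bound (M + magnitude phi).
apply: sub_finite_set (finite_image phi (finite_lattice_box N)).
move=> _ [[a _ <-] _ aM]; exists a => // j /=.
have tau_a := displacement_le tau_fin a.
have tau_a0 := enorm_ge0 (lat a - phi a); have a0 := enorm_ge0 (phi a).
have MN : M + magnitude phi <= N%:R by apply/ltW/archi_boundP; lra.
rewrite -(ler_int R) intr_norm -[N%:Z%:~R]/(N%:R).
have -> : (a 0 j)%:~R = lat a 0 j :> R by rewrite mxE.
apply: le_trans (coord_le_enorm _ _) _; rewrite -[lat a](subrK (phi a)).
by apply: le_trans (enormD _ _) _; lra.
Qed.

(** A point [a] with [enorm (x - a) <= enorm x] has norm at most [2 * enorm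
    x], and only finitely many points of the perturbed lattice are that close
    to the origin. Hence for bounded [x] both cardinality conditions of a
    zone count entries of one sequence. *)
Lemma zone_count M : exists F, [/\ uniq F, forall a, a \in F -> a != 0,
  forall x n, enorm x <= M ->
    ([set a | [/\ P a, a != 0 & (enorm (x - a) < enorm x)%R]] #<= `I_n)%card <->
    (count (fun a => enorm (x - a) < enorm x)%R F <= n)%N &
  forall x n, enorm x <= M ->
    (`I_n #<= [set b | [/\ P b, b != 0 & (enorm (x - b) <= enorm x)%R]])%card <->
    (n <= count (fun b => enorm (x - b) <= enorm x)%R F)%N].
Proof.
have [F [uF FE]] := finite_setE (finite_points (2 * M)).
have memF a : a \in F <-> [/\ P a, a != 0 & enorm a <= 2 * M].
  by have /= <- := congr1 (fun A : set _ => A a) FE.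
have near_a x a : enorm x <= M -> enorm (x - a) <= enorm x -> enorm a <= 2 * M.
  by move=> xM xa; have := enormD (a - x) x; rewrite subrK (enormC a); lra.
exists F; split=> // [a /memF[]//|x n xM|x n xM].
  have -> : [set a | [/\ P a, a != 0 & (enorm (x - a) < enorm x)%R]] =
      [set` [seq a <- F | enorm (x - a) < enorm x]].
    apply/seteqP; split=> a /=; rewrite mem_filter.
      by move=> [Pa a0 xa]; rewrite xa; apply/memF; split=> //; exact/(near_a x)/ltW.
    by move=> /andP[xa /memF[]].
  by rewrite (card_le_eql (card_uniq_seq (filter_uniq _ uF))) card_le_II size_filter.
have -> : [set a | [/\ P a, a != 0 & (enorm (x - a) <= enorm x)%R]] =
    [set` [seq a <- F | enorm (x - a) <= enorm x]].
  apply/seteqP; split=> a /=; rewrite mem_filter.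
    by move=> [Pa a0 xa]; rewrite xa; apply/memF; split=> //; exact/(near_a x).
  by move=> /andP[xa /memF[]].
by rewrite (card_le_eqr (card_uniq_seq (filter_uniq _ uF))) card_le_II size_filter.
Qed.

(** Finitely many strict inequalities between continuous functions persist
    nearby, so the count can only grow. *)
Lemma open_count_gt (T : Type) (F : seq T) (g : T -> 'rV[R]_d -> R) n :
  (forall a, continuous (g a)) ->
  open [set x | (n < count (fun a => 0 < g a x)%R F)%N].
Proof.
move=> gc; rewrite openE => x /= nx; have Fx : Filter (nbhs x) by exact: nbhs_filter.
suff near_count : \forall y \near nbhs x,
    (count (fun a => 0 < g a x)%R F <= count (fun a => 0 < g a y)%R F)%N.
  by apply: (@filterS _ _ Fx _ _ _ near_count) => y; exact: leq_trans.
elim: F {nx} => [|a F IH]; first exact: (@filterE _ _ Fx).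
have near_a : \forall y \near nbhs x, (0 < g a x)%R -> (0 < g a y)%R.
  have [ga|ga] := boolP (0 < g a x); last by apply: (@filterE _ _ Fx).
  have := gc a x _ (open_nbhs_nbhs (conj (@open_gt _ 0) ga)).
  by apply: (@filterS _ _ Fx).
apply: (@filterS2 _ _ Fx _ _ _ _ near_a IH) => y ay Fy; apply: leq_add => //.
by case: (boolP (0 < g a x)) => [/ay ->|].
Qed.

End ZoneFinite.

(** * Two zone points at different distances *)

Section Ray.
Context {R : realType} {d : nat} (d_gt0 : (0 < d)%N).
Implicit Types (x v a b : 'rV[R]_d) (F : seq 'rV[R]_d) (m : nat) (t M : R).

(** A point [t *: v] of a ray is closer to [a] than to the origin if and only
    if [0 < dot a v] and [t] exceeds the threshold [dot a a / (2 * dot a v)].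
    For generic [v] the thresholds are distinct, so between the [m]-th and
    the [m.+1]-st one (the 0-th being 0) there is a whole segment of the zone
    [m.+1]; its end points are the required points. The hypothesis on norm
    [M] provides more than [m] thresholds. *)
Lemma two_points_on_generic_ray F m M : uniq F -> (forall a, a \in F -> a != 0) -> 0 < M ->
  (forall x, enorm x = M ->
    (m < count (fun a => enorm (x - a) < enorm x)%R F)%N) ->
  exists x1 x2, [/\ enorm x1 < enorm x2, enorm x2 <= M &
    forall x, x \in [:: x1; x2] ->
      (count (fun a => enorm (x - a) < enorm x)%R F <= m)%N /\
      (m <= count (fun a => enorm (x - a) <= enorm x)%R F)%N].
Proof.
move=> uF F0 M0 FM.
(* v has equal thresholds for a and b iff it is orthogonal to
   |a|^2 b - |b|^2 a, which is nonzero as inversion in the unit sphere is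
   injective *)
pose L := [seq dot ab.1 ab.1 *: ab.2 - dot ab.2 ab.2 *: ab.1 |
  ab <- [seq (a, b) | a <- F, b <- F] & ab.1 != ab.2].
have [v v0 genv] : exists2 v, v != 0 & forall c, c \in L -> dot c v != 0.
  apply: (exists_generic_direction d_gt0) => c /mapP[[a b]].
  rewrite mem_filter => /andP[/= ab /allpairsP[[a' b'] /= [aF bF [? ?]]]] ->.
  subst a' b'; apply: contra ab; rewrite subr_eq0 => /eqP abE.
  have a0 : 0 < dot a a by rewrite lt_neqAle dot_ge0 eq_sym dot_eq0 F0.
  have b0 : 0 < dot b b by rewrite lt_neqAle dot_ge0 eq_sym dot_eq0 F0.
  have ab0 : dot a a * dot b b != 0 by rewrite mulf_neq0 // gt_eqF.
  have /(mulfI ab0) aabb : dot a a * dot b b * dot a a = dot a a * dot b b * dot b b.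
    have := congr1 (fun c => dot c c) abE; rewrite !dotE => h.
    by lra.
  by move: abE; rewrite aabb => /(scalerI (lt0r_neq0 b0)) ->.
have nv : 0 < enorm v by rewrite lt_neqAle enorm_ge0 eq_sym enorm_eq0 v0.
pose G := [seq a <- F | 0 < dot a v].
pose thr a := dot a a / (2 * dot a v).
pose K := sort <=%R [seq thr a | a <- G].
have GP a : a \in G -> (a \in F) * (0 < dot a v).
  by rewrite mem_filter => /andP[-> ->].
have thr_gt0 a : a \in G -> 0 < thr a.
  move=> /GP[aF av]; rewrite divr_gt0 ?mulr_gt0 //.
  by rewrite lt_neqAle dot_ge0 eq_sym dot_eq0 F0.
have uK : uniq K.
  rewrite sort_uniq map_inj_in_uniq ?filter_uniq // => a b aG bG thr_ab.
  have [aF av] := GP a aG; have [bF bv] := GP b bG.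
  apply: contrapT => /eqP ab.
  have cL : dot a a *: b - dot b b *: a \in L.
    apply/mapP; exists (a, b) => //; rewrite mem_filter ab /=.
    by apply/allpairsP; exists (a, b).
  have /negP := genv _ cL; apply; rewrite !dotE subr_eq0.
  have av2 : 2 * dot a v != 0 by rewrite gt_eqF // mulr_gt0.
  have bv2 : 2 * dot b v != 0 by rewrite gt_eqF // mulr_gt0.
  move/eqP: thr_ab; rewrite /thr eqr_div // => /eqP h.
  by apply/eqP; lra.
have sK : sorted <%R (0 :: K).
  rewrite /= lt_path_sortedE sort_lt_sorted -(sort_uniq <=%R) uK andbT.
  by apply/allP => t; rewrite mem_sort => /mapP[a aG ->]; exact: thr_gt0.
have count_lt t : 0 <= t ->
    count (fun a => enorm (t *: v - a) < enorm (t *: v))%R F = count (< t)%R K.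
  move=> t0; rewrite (permP (permEl (perm_sort _ _))) count_map count_filter.
  apply: eq_in_count => a aF; rewrite enorm_sub_lt dotZl (dotC v) /=.
  have a0 : 0 < dot a a by rewrite lt_neqAle dot_ge0 eq_sym dot_eq0 F0.
  have [av|av] := ltP 0 (dot a v).
    by rewrite andbT /thr ltr_pdivrMr ?mulr_gt0 // mulrCA.
  by rewrite andbF; apply/negbTE; rewrite -leNgt; nra.
have count_le t : 0 <= t ->
    count (fun a => enorm (t *: v - a) <= enorm (t *: v))%R F = count (<= t)%R K.
  move=> t0; rewrite (permP (permEl (perm_sort _ _))) count_map count_filter.
  apply: eq_in_count => a aF; rewrite enorm_sub_le dotZl (dotC v) /=.
  have a0 : 0 < dot a a by rewrite lt_neqAle dot_ge0 eq_sym dot_eq0 F0.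
  have [av|av] := ltP 0 (dot a v).
    by rewrite andbT /thr ler_pdivrMr ?mulr_gt0 // mulrCA.
  by rewrite andbF; apply/negbTE; rewrite -ltNge; nra.
pose T := M / enorm v; have T0 : 0 < T by rewrite divr_gt0.
have Tv : enorm (T *: v) = M by rewrite enormZ gtr0_norm // divfK // gt_eqF.
have mT : (m < count (< T)%R K)%N by rewrite -count_lt ?(ltW T0) // FM.
have mK : (m < size K)%N by apply: leq_trans mT (count_size _ _).
pose t1 := nth 0 (0 :: K) m; pose t2 := nth 0 (0 :: K) m.+1.
have t12 : t1 < t2 by rewrite lt_sorted_ltn_nth // inE /= ltnS // ltnW.
have t10 : 0 <= t1.
  by rewrite /t1 -[leLHS]/(nth 0 (0 :: K) 0%N) lt_sorted_leq_nth // inE /= ltnS ltnW.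
have t2T : t2 < T by apply: (nth_count_lt 0 _ mT); exact: sort_le_sorted.
have t20 : 0 < t2 by apply: le_lt_trans t12.
(* 0 :: K is strictly sorted, so the counts at its entries are their positions;
   the leading 0 is then subtracted *)
have c1 : count (< t1) (0 :: K) = m by apply: count_lt_nth => //=; exact: ltnW.
have c1' : count (<= t1) (0 :: K) = m.+1 by apply: count_le_nth => //=; exact: ltnW.
have c2 : count (< t2) (0 :: K) = m.+1 by apply: count_lt_nth.
have c2' : count (<= t2) (0 :: K) = m.+2 by apply: count_le_nth.
exists (t1 *: v), (t2 *: v); split.
- by rewrite !enormZ !ger0_norm // ?ltr_pM2r // ltW.
- by rewrite -Tv !enormZ !gtr0_norm // ler_pM2r // ltW.
move=> x; rewrite !inE => /orP[] /eqP ->; rewrite count_lt ?count_le ?(ltW t20) //.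
- split; first by rewrite -c1 /= leq_addl.
  by have := c1'; rewrite /= t10 add1n => -[->].
- have := c2; rewrite /= t20 add1n => -[->]; split=> //.
  by have := c2'; rewrite /= (ltW t20) add1n => -[->].
Qed.
End Ray.

(** * Compactness of the zones, and the theorem *)

Section ZoneCompact.
Context {R : realType} {d : nat}.
Context (phi : 'rV[int]_d -> 'rV[R]_d) (tau_fin : has_ubound (displacements phi)).
Local Notation P := (range phi).

Lemma continuous_affine_dot (a : 'rV[R]_d) (c e : R) :
  continuous (fun x => c * dot x a + e).
Proof.
move=> x; have Fx : Filter (nbhs x) by exact: nbhs_filter.
have h : dot y a @[y --> x] --> dot x a.
  by apply: (@dot_continuous R d id (cst a) _ _ x) => y; [exact: cvg_id|exact: cst_continuous].
exact: (cvgD (cvgM (cvg_cst _) h) (cvg_cst _)).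
Qed.

Lemma closed_count_le (F : seq 'rV[R]_d) n :
  closed [set x : 'rV[R]_d | (count (fun a => enorm (x - a) < enorm x)%R F <= n)%N].
Proof.
have cE x : count (fun a => enorm (x - a) < enorm x)%R F =
    count (fun a => 0 < 2 * dot x a - dot a a)%R F.
  by apply: eq_count => a /=; rewrite enorm_sub_lt subr_gt0.
have -> : [set x : 'rV[R]_d | (count (fun a => enorm (x - a) < enorm x)%R F <= n)%N] =
    ~` [set x | (n < count (fun a => 0 < 2 * dot x a - dot a a)%R F)%N].
  apply/seteqP; split=> x /=; rewrite cE; last by move/negP; rewrite -leqNgt.
  by rewrite leqNgt => /negP.
apply: open_closedC; apply: open_count_gt => a.
exact: (continuous_affine_dot (a := a) (c := 2) (e := - dot a a)).
Qed.

(** The points that fail the weak inequality satisfy the opposite strict one. *)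
Lemma closed_count_ge (F : seq 'rV[R]_d) n :
  closed [set x : 'rV[R]_d | (n <= count (fun a => enorm (x - a) <= enorm x)%R F)%N].
Proof.
have cE x : (count (fun a => enorm (x - a) <= enorm x)%R F +
    count (fun a => 0 < -2 * dot x a + dot a a)%R F)%N = size F.
  rewrite -(count_predC (fun a => enorm (x - a) <= enorm x)%R F); congr (_ + _)%N.
  by apply: eq_count => a /=; rewrite enorm_sub_le -ltNge; apply/idP/idP; lra.
have [nF|nF] := leqP n (size F); last first.
  rewrite (_ : [set x | _] = set0); first exact: closed0.
  apply/seteqP; split=> x //= /leq_trans/(_ (count_size _ _)).
  by rewrite leqNgt nF.
have nE x : (n <= count (fun a => enorm (x - a) <= enorm x)%R F)%N =
    ~~ (size F - n < count (fun a => 0 < -2 * dot x a + dot a a)%R F)%N.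
  by have := cE x; rewrite -leqNgt; lia.
have -> : [set x : 'rV[R]_d | (n <= count (fun a => enorm (x - a) <= enorm x)%R F)%N] =
    ~` [set x | (size F - n < count (fun a => 0 < -2 * dot x a + dot a a)%R F)%N].
  by apply/seteqP; split=> x /=; rewrite nE => /negP.
apply: open_closedC; apply: open_count_gt => a.
exact: (continuous_affine_dot (a := a) (c := -2) (e := dot a a)).
Qed.

(** On a ball that contains the zone, both conditions of [zone_count] are
    closed. *)
Lemma zone_compact k M : (forall x, zone k P x -> enorm x <= M) -> compact (zone k P).
Proof.
move=> zM; apply: bounded_closed_compact; first exact: bounded_enorm zM.
have [F [_ _ F_lt F_le]] := zone_count tau_fin M.
rewrite (_ : zone k P = [set x | enorm x <= M] `&`
    ([set x : 'rV[R]_d | (count (fun a => enorm (x - a) < enorm x)%R F <= k.-1)%N] `&`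
    [set x : 'rV[R]_d | (k.-1 <= count (fun a => enorm (x - a) <= enorm x)%R F)%N])).
  apply: closedI; first exact: closed_enorm_le.
  by apply: closedI; [exact: closed_count_le|exact: closed_count_ge].
apply/seteqP; split=> x.
  by move=> zx; have xM := zM _ zx; case: zx => /(F_lt x _ xM) c1 /(F_le x _ xM) c2.
by move=> [xM [c1 c2]]; split; [exact/F_lt|exact/F_le].
Qed.
End ZoneCompact.

(* The first inequality is strict except for the identity Z -> R (d = 1 and
   tau = 0), where it is an equality: zone k of Z is (k-1)/2 <= |x| <= k/2,
   while k / nu_1 - 1/2 = (k-1)/2. *)
Theorem theorem3p2 (R : realType) (d : nat) (phi : 'rV[int]_d -> 'rV[R]_d)
    (k : nat) (d_gt0 : (0 < d)%N) (phi_inj : injective phi)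
    (phi0 : phi 0 = 0) (tau_fin : has_ubound (displacements phi))
    (k_ge1 : (1 <= k)%N) :
  let tau := magnitude phi in
  let rho := (k%:R / unit_ball_volume R d) `^ (d%:R^-1) in
  let P := range phi in
  let dists := [set enorm x | x in zone k P] in
  exists rk Rk : R,
    [/\ is_minimum dists rk,
        is_maximum dists Rk,
        rho - Num.sqrt d%:R / 2 - tau < rk ?<= if (d == 1%N) && (tau == 0),
        rk < Rk /\ Rk < rho + Num.sqrt d%:R / 2 + tau
      & Rk - rk < Num.sqrt d%:R + 2 * tau].
Proof.
move=> tau rho P dists.
pose M := rho + Num.sqrt d%:R / 2 + tau.
have zM x : zone k P x -> enorm x < M.
  by case=> cx _; apply: zone_enorm_lt cx.
have rho0 : 0 < rho by apply: ball_radius_gt0; rewrite // ltr0n.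
have tau0 : 0 <= tau by exact: magnitude_ge0.
have dg : 1 <= Num.sqrt d%:R :> R by exact: diag_ge1.
have M0 : 0 < M by rewrite /M; lra.
have [F [uF F0 F_lt F_le]] := zone_count tau_fin M.
have [|x1 [x2 [x12 x2M x12F]]] := two_points_on_generic_ray d_gt0 uF F0 M0 (m := k.-1).
  move=> x xM; rewrite ltnNge; apply/negP => cx.
  have : enorm x < M by apply: zone_enorm_lt => //; apply/F_lt => //; rewrite xM.
  by rewrite xM ltxx.
have zone_x12 x : x \in [:: x1; x2] -> zone k P x.
  move=> xx; have [c1 c2] := x12F x xx.
  have xM : enorm x <= M.
    by move: xx; rewrite !inE => /orP[] /eqP -> //; apply: ltW (lt_le_trans x12 x2M).
  by split; [exact/F_lt|exact/F_le].
have zx1 : zone k P x1 by apply: zone_x12; rewrite mem_head.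
have zx2 : zone k P x2 by apply: zone_x12; rewrite !inE eqxx orbT.
have z0 : zone k P !=set0 by exists x1.
have cz : compact (zone k P) by apply: (zone_compact tau_fin (M := M)) => x /zM /ltW.
have ce : {within zone k P, continuous (@enorm R d)}.
  by apply: continuous_subspaceT => x; exact: enorm_continuous.
have [y /set_mem zy ymin] := compact_EVT_min z0 cz ce.
have [z /set_mem zz zmax] := compact_EVT_max z0 cz ce.
have ylow : rho <= enorm y + tau + Num.sqrt d%:R / 2.
  by apply: ball_radius_le_zone zy.2.
have zup := zM z zz.
exists (enorm y), (enorm z); split.
- by split; [exists y|move=> _ [x zx <-]; apply: ymin; exact/mem_set].
- by split; [exists z|move=> _ [x zx <-]; apply: zmax; exact/mem_set].
- rewrite /Order.lteif; case: ifPn => [_|]; first by lra.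
  move=> dt; suff : rho < enorm y + tau + Num.sqrt d%:R / 2 by lra.
  apply: ball_radius_lt_zone zy.2 => //.
  move: dt; rewrite negb_and => /orP[d1|t0]; apply/orP; [left|right].
    by rewrite ltn_neqAle eq_sym d1.
  by rewrite lt_neqAle eq_sym t0.
- split=> //; apply: le_lt_trans (ymin x1 (mem_set zx1)) _.
  by apply: lt_le_trans x12 (zmax x2 (mem_set zx2)).
- by move: zup; rewrite /M; lra.
Qed.
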